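(* Let $q$ be a prime power and let $k, v_1, v_2$ be positive integers with $v_2\ge 2k$. Let $\mathcal{C}_1$ be a set of $k$-dimensional subspaces of $\mathbb{F}_q^{v_1}$ such that any two distinct elements intersect in a subspace of dimension at most $1$. Let $\mathcal{C}_1^C\subseteq \mathcal{C}_1$ be a subset whose elements pairwise intersect trivially (i.e., in the zero subspace). Let $\mathcal{C}_2$ be a set of $k$-dimensional subspaces of $\mathbb{F}_q^{v_2}$ such that any two distinct elements intersect in a subspace of dimension at most $1$, with $\#\mathcal{C}_2\ge 1$. Suppose that $\mathbb{F}_q^{v_2}$ contains a $(v_2-k)$-dimensional subspace $S$ such that exactly $\Lambda$ elements of $\mathcal{C}_2$ are contained in $S$ and every other element of $\mathcal{C}_2$ intersects $S$ in a subspace of dimension at most $1$. Then $$A_q(v_1+v_2-k,2k-2;k)\ge \#\mathcal{C}_1\cdot q^{2(v_2-k)}+\#\mathcal{C}_1^C\cdot\left(\#\mathcal{C}_2-q^{2(v_2-k)}-\Lambda\right)+\Lambda.$$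
   Context: For a prime power $q$ and integers $v,d,k$, $A_q(v,d;k)$ denotes the maximum number of $k$-dimensional subspaces of $\mathbb{F}_q^v$ such that any two distinct ones $U,W$ have subspace distance $\mathrm{d}_{\mathrm{s}}(U,W)=\dim(U)+\dim(W)-2\dim(U\cap W)\ge d$. In particular $A_q(v,2k-2;k)$ is the maximum number of $k$-subspaces of $\mathbb{F}_q^v$ pairwise intersecting in a subspace of dimension at most $1$.
   Formalization: The formal theorem assumes k ≥ 2 instead of k ≥ 1; for k = 1 the claim fails, e.g. v_1 = 1, v_2 = 2, C_1 = {F_q^1}, C_1^C empty, C_2 one point, S another point, Λ = 0, which would give q+1 ≥ q^2. *)

(* Defs.v *)
From HB Require Import structures.
From mathcomp Require Import all_boot all_order all_algebra.
Set Implicit Arguments.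
Unset Strict Implicit.
Unset Printing Implicit Defensive.

Import VectorInternalTheory.

(* The library makes {vspace vT} only a choiceType; over a finite field it is
   finite, being a subtype of a type of square matrices. *)
HB.instance Definition _ (F : finFieldType) (vT : vectType F) :=
  [Countable of {vspace vT} by <:].
HB.instance Definition _ (F : finFieldType) (vT : vectType F) :=
  [Finite of {vspace vT} by <:].

(* The truncated subtraction is exact: \dim (U :&: W) <= \dim U, \dim W. *)
Definition subspace_dist (F : fieldType) (vT : vectType F)
    (U W : {vspace vT}) : nat :=
  \dim U + \dim W - 2 * \dim (U :&: W)%VS.

Definition constant_dim_code (F : finFieldType) (v d k : nat)
    (C : {set {vspace 'rV[F]_v}}) : bool :=
  [forall U in C, \dim U == k]
  && [forall U in C, forall W in C, (U != W) ==> (d <= subspace_dist U W)].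

(* A_q(v, d; k) for q = #|F|; the maximum runs over a nonempty family, since
   the empty set is a code. *)
Definition Aq (F : finFieldType) (v d k : nat) : nat :=
  \max_(C : {set {vspace 'rV[F]_v}} | constant_dim_code d k C) #|C|.

(* Main.v *)
Require Import Defs.
From mathcomp Require Import all_boot all_order all_algebra all_field ring.

(* Write m = v2 - k and let S' = 0 x F^m in the ambient space F^v1 x F^m.
   Over each U in C1 sits the v2-dimensional space U x F^m, which contains S'.
   If U is not in C1C, fill it with the q^(2m) graphs of the maps U -> F^m of a
   Gabidulin code (the maps x |-> a x + c x^q over the degree m extension of F;
   a nonzero one has at most q roots, i.e. a kernel of dimension at most 1);
   these graphs meet S' trivially.  If U is in C1C, fill it with a copy of C2 in
   which S corresponds to S', leaving out the Lambda codewords inside S; finally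
   add those Lambda codewords once, inside S'.  Codewords over distinct U and W
   meet in dimension at most dim (U :&: W) plus the dimension of the
   intersection of either one with S'. *)

Set Implicit Arguments.
Unset Strict Implicit.
Unset Printing Implicit Defensive.

Import Order.TTheory GRing.Theory Num.Theory.
Local Open Scope ring_scope.

(** * Finite field extensions of prescribed degree *)

(** [L] is the splitting field of [X^n - X] with [n = #|F|^m]. The roots are the fixed points of the
    [m]-th power of the Frobenius [a], so they form a subfield and hence all of [L]. They are
    distinct, so [L] has [n] elements. *)
Lemma finField_extension (F : finFieldType) (m : nat) : (0 < m)%N ->
  exists L : splittingFieldType F, \dim {:L} = m.
Proof.
move=> m_gt0; pose n := (#|F| ^ m)%N.
have F_gt1 : (1 < #|F|)%N := finNzRing_gt1 F.
have n_gt1 : (1 < n)%N by rewrite -(expn0 #|F|) ltn_exp2l.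
have n1_gt0 : (0 < n.-1)%N by rewrite -ltnS prednK // ltnW.
pose p (R : nzRingType) : {poly R} := 'X^n - 'X.
have Dp R : p R = ('X^(n.-1) - 1) * ('X - 0).
  by rewrite subr0 mulrBl mul1r -exprSr prednK // ltnW.
have /FinSplittingFieldFor[/= L]: p F != 0.
  by rewrite Dp monic_neq0 ?rpredM ?monicXsubC ?monicXnsubC.
rewrite rmorphB rmorphXn /= map_polyX -/(p L) => -[zs DpL defL].
exists L.
have [a _ Da] := finField_galois_generator (sub1v {:L}%AS).
rewrite /= dimv1 expn1 in Da.
have n0 : n%:R = 0 :> L.
  have [r r_pr charF] := finPcharP F.
  have charL : r \in [pchar L] by rewrite pchar_lalg.
  have oF : #|F| = (r ^ logn r #|F|)%N := card_pprimeChar charF.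
  have l_gt0 : (0 < logn r #|F|)%N.
    by case: (logn _ _) oF F_gt1 => // ->.
  rewrite /n oF -expnM natrX pcharf0 // expr0n gtn_eqF //.
  by rewrite muln_gt0 l_gt0.
(* Since [n = 0] in [L], the exponent [n - 1] is nonzero there, so [X^(n-1) - 1] is separable; 0 is
   not one of its roots. *)
have Uzs: uniq zs.
  rewrite -separable_prod_XsubC -(eqp_separable DpL) Dp separable_root andbC.
  rewrite /root !hornerE subr_eq0 eq_sym expr0n gtn_eqF ?oner_eq0 //=.
  rewrite cyclotomic.separable_Xn_sub_1 // -subn1 natrB ?(ltnW n_gt1) //.
  by rewrite n0 sub0r oppr_eq0 oner_eq0.
pose E := fixedSpace (a ^+ m)%g.
have in_zs : zs =i E.
  move=> z; rewrite -root_prod_XsubC -(eqp_root DpL) (sameP fixedSpaceP eqP).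
  rewrite /root !hornerE subr_eq0 /= /n; congr (_ == z).
  elim: (m) => [|i IHi]; first by rewrite gal_id.
  by rewrite expgSr expnSr exprM IHi galM ?Da ?memvf.
have defE : E = {:L}%VS.
  apply/eqP; rewrite eqEsubv subvf -defL -[E]subfield_closed agenvS //.
  by rewrite subv_add sub1v; apply/span_subvP=> z; rewrite in_zs.
pose fL := finvect_type L.
apply: (expnI F_gt1); rewrite -(@card_vspace F fL (Vector.class L) fullv) -/n.
have zsE : (fullv : {vspace L}) =i (zs : seq fL).
  by move=> z; rewrite in_zs defE.
rewrite (eq_card (T := fL) zsE).
apply: succn_inj; rewrite (card_uniqP _) //= -(size_prod_XsubC _ id).
by rewrite -(eqp_size DpL) size_polyDl size_polyXn // size_polyN size_polyX.
Qed.

(** * The Gabidulin code *)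

Lemma gabidulin_code (F : finFieldType) (k m : nat) : (1 < k <= m)%N ->
  exists2 G : {set 'M[F]_(k, m)}, #|G| = (#|F| ^ (2 * m))%N
  & {in G &, forall A B, A != B ->
      (\dim (lker (linfun (mulmxr (A - B) : 'rV[F]_k -> 'rV[F]_m))) <= 1)%N}.
Proof.
case/andP=> k_gt1 le_k_m.
have [L] := finField_extension F (leq_trans (ltnW k_gt1) le_k_m).
move: le_k_m => /[swap] <- {m}; set m := \dim _ => le_k_m.
set q := #|F|; have q_gt1 : (1 < q)%N := finNzRing_gt1 F.
have [a _ Da] := finField_galois_generator (sub1v {:L}%AS).
rewrite /= dimv1 expn1 -/q in Da.
pose b := vbasis {:L}%VS.
have free_b : free b := basis_free (vbasisP _).
(* The matrix of [x |-> c.1 x + c.2 x^q], restricted to the span of the first [k] basis vectors of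
   [L]; [toL] identifies [F^k] with that span. *)
pose phi (c : L * L) : 'M[F]_(k, m) :=
  \matrix_(i, j) coord b j (c.1 * b`_i + c.2 * b`_i ^+ q).
pose toL (u : 'rV[F]_k) := \sum_i u 0 i *: b`_i : L.
have toL_inj : injective toL.
  have toLK u i : coord b (widen_ord le_k_m i) (toL u) = u 0 i.
    rewrite /toL linear_sum (bigD1 i) //= linearZ /=.
    rewrite (coord_free (widen_ord le_k_m i) (widen_ord le_k_m i)) // eqxx.
    rewrite mulr1 big1 ?addr0 // => j ne_ji; rewrite linearZ /=.
    rewrite (coord_free (widen_ord le_k_m j) (widen_ord le_k_m i)) //.
    by rewrite -val_eqE /= val_eqE (negPf ne_ji) mulr0.
  by move=> u v eq_uv; apply/rowP=> i; rewrite -!toLK eq_uv.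
have phiE u c : u *m phi c = 0 -> c.1 * toL u + c.2 * toL u ^+ q = 0.
  move=> uc0; rewrite [LHS](coord_vbasis (memvf _)) big1 // => j _.
  rewrite -[RHS](scale0r b`_j); congr (_ *: _).
  have /rowP/(_ j) := uc0; rewrite !mxE => {uc0} uc0.
  suff -> : c.1 * toL u + c.2 * toL u ^+ q =
      \sum_i u 0 i *: (c.1 * b`_i + c.2 * b`_i ^+ q).
    rewrite linear_sum -[RHS]uc0.
    by apply: eq_bigr => i _; rewrite linearZ /= mxE.
  (* Written as the Galois automorphism [a], the [q]-th power map is visibly [F]-linear. *)
  rewrite -Da ?memvf // /toL linear_sum !mulr_sumr -big_split /=.
  by apply: eq_bigr => i _; rewrite linearZ /= Da ?memvf // -!scalerAr scalerDr.
have phiB c d : phi c - phi d = phi (c - d).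
  apply/matrixP=> i j; rewrite !mxE -linearB /=; congr (coord _ _ _).
  by rewrite !mulrBl opprD addrACA.
(* The elements [toL u] for [u] in the kernel are roots of [c.1 X + c.2 X^q]. *)
have ker_phi c : c != 0 ->
    (\dim (lker (linfun (mulmxr (phi c) : 'rV[F]_k -> 'rV[F]_m))) <= 1)%N.
  move=> nz_c; set K := lker _; pose P : {poly L} := c.1 *: 'X + c.2 *: 'X^q.
  have nzP : P != 0.
    apply: contraNneq nz_c => P0; have PE i : P`_i = 0 by rewrite P0 coef0.
    have := PE 1%N; have := PE q.
    rewrite !(coefD, coefZ, coefX, coefXn) eqxx (gtn_eqF q_gt1) (ltn_eqF q_gt1).
    rewrite !mulr0 !mulr1 addr0 add0r => c2 c1.
    by case: (c) c1 c2 => c1 c2 /= -> ->.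
  rewrite -(leq_exp2l _ _ q_gt1) expn1 -(card_vspace (T := 'rV[F]_k)).
  rewrite -(size_image toL) -ltnS.
  have szP : (size P <= q.+1)%N.
    rewrite (leq_trans (size_polyD _ _)) // geq_max.
    rewrite !(leq_trans (size_scale_leq _ _)) ?size_polyX ?size_polyXn //.
    by rewrite ltnS ltnW.
  apply: leq_trans szP; apply: max_poly_roots => //.
    apply/allP=> _ /imageP[u Ku ->]; rewrite rootE !hornerE.
    by rewrite phiE //; apply/eqP; move: Ku; rewrite memv_ker lfunE.
  by rewrite map_inj_uniq ?enum_uniq.
have ker0 : \dim (lker (linfun (mulmxr 0 : 'rV[F]_k -> 'rV[F]_m))) = k.
  have -> : lker (linfun (mulmxr 0 : 'rV[F]_k -> 'rV[F]_m)) = fullv.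
    by apply/vspaceP=> u; rewrite memvf memv_ker lfunE /= mulmx0 eqxx.
  by rewrite dimvf dim_matrix mul1r.
pose fL := finvect_type L.
(* If [c] and [d] had the same matrix, [phi (c - d)] would be zero, with a kernel of dimension
   [k > 1]. *)
have phi_inj : injective (phi : fL * fL -> _).
  move=> c d eq_cd; apply/eqP; rewrite -subr_eq0; apply/negPn/negP => /ker_phi.
  by rewrite -phiB eq_cd subrr ker0 leqNgt k_gt1.
exists [set phi c | c : fL * fL].
  rewrite card_imset // card_prod mulnn.
  rewrite -[#|fL|](card_vspacef (Vector.class L : Vector F fL)).
  by rewrite (@card_vspace F fL (Vector.class L)) -expnM mulnC.
move=> _ _ /imsetP[c _ ->] /imsetP[d _ ->] ne_cd; rewrite phiB ker_phi //.
by rewrite subr_eq0; apply: contraNneq ne_cd => ->.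
Qed.

(** * Indexed codes and auxiliary linear algebra *)

(** Counting indices suffices: two indices with the same subspace would give an intersection of
    dimension [k > 1]. *)
Lemma leq_card_Aq (F : finFieldType) (n k : nat) (I : finType) (A : {set I})
    (f : I -> {vspace 'rV[F]_n}) : (1 < k)%N ->
  {in A, forall i, \dim (f i) = k} ->
  {in A &, forall i j, i != j -> (\dim (f i :&: f j) <= 1)%N} ->
  (#|A| <= Aq F n (2 * k - 2) k)%N.
Proof.
move=> k_gt1 dimf capf.
have f_inj : {in A &, injective f}.
  move=> i j Ai Aj eq_f; apply/eqP/negPn/negP => /(capf i j Ai Aj).
  by rewrite -eq_f capvv dimf // leqNgt k_gt1.
rewrite -(card_in_imset f_inj) /Aq.
apply: (leq_bigmax_cond (F := fun C : {set {vspace 'rV[F]_n}} => #|C|)).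
apply/andP; split; first by apply/forall_inP=> _ /imsetP[i Ai ->]; rewrite dimf.
apply/forall_inP=> _ /imsetP[i Ai ->]; apply/forall_inP=> _ /imsetP[j Aj ->].
apply/implyP=> ne_f; rewrite /subspace_dist !dimf // addnn -mul2n leq_sub2l //.
apply: (@leq_mul 2 _ 2 1) => //; apply: capf => //.
by apply: contraNneq ne_f => ->.
Qed.

(** Injectivity is asked on [T] only, so that the lemma also covers [embed 0], which is injective on
    the second factor alone when [k > 0]. *)
Lemma limg_cap_in (F : fieldType) (aT rT : vectType F) (f : 'Hom(aT, rT))
    (T U V : {vspace aT}) :
  (lker f :&: T)%VS = 0%VS -> (U <= T)%VS -> (V <= T)%VS ->
  (f @: U :&: f @: V)%VS = (f @: (U :&: V))%VS.
Proof.
move=> kerf sUT sVT; apply/eqP; rewrite eqEsubv limg_cap andbT.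
apply/subvP=> _ /memv_capP[/memv_imgP[u Uu ->] /memv_imgP[v Vv] eq_f].
suff eq_uv : u = v by apply: memv_img; rewrite memv_cap Uu eq_uv.
apply/eqP; rewrite -subr_eq0 -memv0 -kerf memv_cap memv_ker linearB /= eq_f.
by rewrite subrr eqxx /= memvB ?(subvP sUT u Uu) ?(subvP sVT v Vv).
Qed.

Lemma lker0_of_limgf (F : fieldType) (vT wT : vectType F) (f : 'Hom(vT, wT)) :
  \dim {:vT} = \dim {:wT} -> limg f = fullv -> lker f = 0%VS.
Proof.
move=> dim_eq f_onto; apply/eqP; rewrite -dimv_eq0 -(eqn_add2r (\dim (limg f))).
by rewrite -{1}(capfv (lker f)) limg_ker_dim f_onto dim_eq.
Qed.

(** Bases of [U] and of a complement are sent to bases of [W] and of a complement. The map is onto,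
    hence injective by dimension. *)
Lemma exists_iso_limg (F : fieldType) (vT wT : vectType F) (U : {vspace vT})
    (W : {vspace wT}) :
  \dim {:vT} = \dim {:wT} -> \dim U = \dim W ->
  exists2 f : 'Hom(vT, wT), lker f = 0%VS & (f @: U)%VS = W.
Proof.
move=> dim_full dim_eq.
pose X := (vbasis U ++ vbasis U^C)%VS; pose Y := (vbasis W ++ vbasis W^C)%VS.
have [f fXY] := linear_of_free X Y.
have freeX : free X.
  rewrite cat_free !(basis_free (vbasisP _)) /=.
by rewrite directvE /= !(span_basis (vbasisP _)) dimv_disjoint_sum ?capv_compl.
have {fXY} : map f X = Y.
  by apply: fXY; rewrite ?size_cat ?size_tuple ?dimv_compl ?dim_eq ?dim_full.
have eq_size : size (map f (vbasis U)) = size (vbasis W).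
  by rewrite size_map !size_tuple.
rewrite map_cat => /eqP; rewrite eqseq_cat // => /andP[/eqP fU /eqP fUC].
pose g := linfun f; have gE : g =1 f by move=> x; rewrite lfunE.
have gU : (g @: U)%VS = W.
  rewrite -(span_basis (vbasisP U)) limg_span (eq_map gE) fU.
  exact: span_basis (vbasisP W).
exists g => //; apply: lker0_of_limgf => //.
rewrite -(addv_complf U) limgD gU -(span_basis (vbasisP U^C)).
by rewrite limg_span (eq_map gE) fUC (span_basis (vbasisP W^C)) addv_complf.
Qed.

(** * The spaces [U x F^m] over the subspaces [U] of [F^n] *)

Section Construction.

Variables (F : fieldType) (k m n : nat).

Definition lproj p : 'Hom('rV[F]_(p + m), 'rV[F]_p) := linfun lsubmx.

(* For [\dim U < k] the missing rows are zero, so [basis_mx 0 = 0]. *)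
Definition basis_mx (U : {vspace 'rV[F]_n}) : 'M[F]_(k, n) :=
  \matrix_(i < k) (vbasis U)`_i.

(** For [\dim U = k] this identifies [F^(k + m)] with [U x F^m], so a code to be placed over every
    such [U] need be given only once. *)
Definition embed (U : {vspace 'rV[F]_n}) :
    'Hom('rV[F]_(k + m), 'rV[F]_(n + m)) :=
  linfun (mulmxr (block_mx (basis_mx U) 0 0 1%:M)).

Lemma lprojE p (v : 'rV[F]_(p + m)) : lproj p v = lsubmx v.
Proof. by rewrite lfunE. Qed.

Lemma mul_basis_mx U (y : 'rV[F]_k) :
  y *m basis_mx U = \sum_i y 0 i *: (vbasis U)`_i.
Proof. by rewrite mulmx_sum_row; apply: eq_bigr => i _; rewrite rowK. Qed.

Lemma mem_mul_basis_mx U (y : 'rV[F]_k) : y *m basis_mx U \in U.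
Proof.
rewrite mul_basis_mx memv_suml // => i _; rewrite memvZ //.
have [lt_i|le_i] := ltnP i (\dim U).
  by rewrite vbasis_mem // mem_nth // size_tuple.
by rewrite nth_default ?size_tuple ?mem0v.
Qed.

Lemma mul_basis_mx_eq0 U (y : 'rV[F]_k) :
  \dim U = k -> y *m basis_mx U = 0 -> y = 0.
Proof.
move=> dimU; rewrite mul_basis_mx => y0; apply/rowP=> i; rewrite mxE.
have /freeP free_U := basis_free (vbasisP U).
rewrite -(free_U (fun j => y 0 (cast_ord dimU j)) _ (cast_ord (esym dimU) i)).
  by rewrite cast_ordKV.
rewrite -[RHS]y0 [RHS](reindex (cast_ord dimU)) //.
exact/onW_bij/(Bijective (cast_ordK dimU) (cast_ordKV dimU)).
Qed.

Lemma embedE U v : embed U v = row_mx (lsubmx v *m basis_mx U) (rsubmx v).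
Proof.
rewrite lfunE /= -{1}[v]hsubmxK mul_row_block !mulmx0 mulmx1 addr0 add0r.
by [].
Qed.

Lemma lproj_embed U v : lproj n (embed U v) = lproj k v *m basis_mx U.
Proof. by rewrite !lprojE embedE row_mxKl. Qed.

Lemma limg_lproj_embed U X : (lproj n @: (embed U @: X) <= U)%VS.
Proof.
apply/subvP=> _ /memv_imgP[_ /memv_imgP[v _ ->] ->].
by rewrite lproj_embed mem_mul_basis_mx.
Qed.

Lemma lker_embed_cap U : (lker (embed U) :&: lker (lproj k) = 0)%VS.
Proof.
apply/eqP; rewrite -subv0; apply/subvP=> v; rewrite memv_cap !memv_ker memv0.
rewrite lprojE embedE => /andP[/eqP Ev0 /eqP lv0].
move: Ev0; rewrite -[0 in RHS]row_mx0 => /eq_row_mx[_ rv0].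
by rewrite -[v]hsubmxK lv0 rv0 row_mx0.
Qed.

Lemma lker_embed U : \dim U = k -> lker (embed U) = 0%VS.
Proof.
move=> dimU; rewrite -(lker_embed_cap U); apply/esym/capv_idPl/subvP=> v.
rewrite !memv_ker => /eqP Ev0; apply/eqP/(mul_basis_mx_eq0 dimU).
by rewrite -lproj_embed Ev0 linear0.
Qed.

(** The rows of [basis_mx U] are independent, so an image vector with zero left part comes from a
    vector with zero left part. *)
Lemma dim_embed_cap U X : \dim U = k ->
  (\dim (embed U @: X :&: lker (lproj n)) <= \dim (X :&: lker (lproj k)))%N.
Proof.
move=> dimU; rewrite -(limg_dim_eq (f := embed U) (U := X :&: _)); last first.
  by rewrite lker_embed ?capv0.
apply/dimvS/subvP=> _ /memv_capP[/memv_imgP[v Xv ->]].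
rewrite memv_ker lproj_embed => /eqP/(mul_basis_mx_eq0 dimU) v0.
by rewrite memv_img // memv_cap Xv memv_ker v0 eqxx.
Qed.

(** Rank-nullity for [lproj n] on the intersection: the image lies in [U :&: W], the kernel in the
    last term. *)
Lemma dim_embed_cap2 U W X Y :
  (\dim (embed U @: X :&: embed W @: Y)
    <= \dim (U :&: W) + \dim (embed U @: X :&: lker (lproj n)))%N.
Proof.
rewrite -(limg_ker_dim (lproj n)) addnC leq_add // dimvS //.
  rewrite subv_cap; apply/andP; split.
    exact: subv_trans (limgS _ (capvSl _ _)) (limg_lproj_embed _ _).
  exact: subv_trans (limgS _ (capvSr _ _)) (limg_lproj_embed _ _).
exact: capvS (capvSl _ _) (subvv _).
Qed.

End Construction.

(** * Linking the codes over the different [U] *)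

(** [G] is used over [C :\: CC], [D] over [CC], and [E] once inside the common subspace. Codewords
    are indexed by pairs (base space, local codeword). *)
Lemma leq_linked_code_Aq (F : finFieldType) (k m n : nat)
    (C CC : {set {vspace 'rV[F]_n}}) (G D E : {set {vspace 'rV[F]_(k + m)}})
    (S := lker (lproj F m k)) :
  (1 < k)%N ->
  {in C, forall U, \dim U = k} ->
  {in C &, forall U W, U != W -> (\dim (U :&: W) <= 1)%N} ->
  CC \subset C ->
  {in CC &, forall U W, U != W -> (U :&: W)%VS = 0%VS} ->
  {in G, forall X, \dim X = k} ->
  {in G &, forall X Y, X != Y -> (\dim (X :&: Y) <= 1)%N} ->
  {in G, forall X, (X :&: S)%VS = 0%VS} ->
  {in D, forall X, \dim X = k} ->
  {in D &, forall X Y, X != Y -> (\dim (X :&: Y) <= 1)%N} ->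
  {in D, forall X, (\dim (X :&: S) <= 1)%N} ->
  {in E, forall X, \dim X = k} ->
  {in E &, forall X Y, X != Y -> (\dim (X :&: Y) <= 1)%N} ->
  {in E, forall X, (X <= S)%VS} ->
  (#|C :\: CC| * #|G| + #|CC| * #|D| + #|E| <= Aq F (n + m) (2 * k - 2) k)%N.
Proof.
move=> k_gt1 dimC capC sCC capCC dimG capG capGS dimD capD capDS dimE capE sES.
have C0 : 0%VS \notin C.
  by apply/negP => /dimC; rewrite dimv0 => k0; rewrite -k0 in k_gt1.
have CC0 : 0%VS \notin CC by apply: contra C0; apply: subsetP.
pose A1 := setX (C :\: CC) G; pose A2 := setX CC D.
(* [0] is free to serve as an extra index since [0 \notin C]; [embed 0] kills
   the first factor and is injective on [S]. *)
pose A3 := setX [set 0%VS : {vspace 'rV[F]_n}] E.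
have -> : (#|C :\: CC| * #|G| + #|CC| * #|D| + #|E| = #|A1 :|: A2 :|: A3|)%N.
  rewrite !cardsU !cardsX cards1 mul1n.
  have -> : A1 :&: A2 = set0.
    by apply/setP=> -[U X]; rewrite !inE; case: (U \in CC); rewrite //= andbF.
  have -> : (A1 :|: A2) :&: A3 = set0.
    apply/setP=> -[U X]; rewrite !inE /=.
    have [->|] := eqVneq U; last by rewrite andbF.
    by rewrite (negPf C0) (negPf CC0) andbF.
  by rewrite !cards0 !subn0.
pose f (i : _ * _) : {vspace 'rV[F]_(n + m)} := (embed k m i.1 @: i.2)%VS.
pose S' := lker (lproj F m n).
have AP U X : (U, X) \in A1 :|: A2 :|: A3 ->
    [\/ [/\ U \in C, U \notin CC & X \in G], U \in CC /\ X \in D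
      | U = 0%VS /\ X \in E].
  rewrite !inE -orbA /= -andbA.
  case/or3P=> [/and3P[UCC UC XG]|/andP[UC XD]|/andP[/eqP-> XE]].
  - by constructor 1.
  - by constructor 2.
  by constructor 3.
have dimCC U : U \in CC -> \dim U = k by move/(subsetP sCC)/dimC.
have capG' U X : U \in C -> X \in G -> \dim (f (U, X) :&: S') = 0%N.
  move=> UC XG; apply/eqP; rewrite -leqn0.
  by rewrite (leq_trans (dim_embed_cap _ (dimC U UC))) // capGS ?dimv0.
have capD' U X : U \in CC -> X \in D -> (\dim (f (U, X) :&: S') <= 1)%N.
  by move=> UC XG; rewrite (leq_trans (dim_embed_cap _ (dimCC U UC))) ?capDS.
(* [dim_embed_cap2] involves only one of the two codewords with [S']; the two versions allow
   choosing which. *)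
have boundl U W X Y (d := \dim (U :&: W)) :
    (d + \dim (f (U, X) :&: S') <= 1)%N ->
    (\dim (f (U, X) :&: f (W, Y)) <= 1)%N.
  by move=> le1; apply: leq_trans le1; apply: dim_embed_cap2.
have boundr U W X Y (d := \dim (U :&: W)) :
    (d + \dim (f (W, Y) :&: S') <= 1)%N ->
    (\dim (f (U, X) :&: f (W, Y)) <= 1)%N.
  by rewrite /d (capvC U) (capvC (f (U, X))); apply: boundl.
apply: (leq_card_Aq (f := f)) => // [[U X] /AP|[U X] [W Y] /AP UX /AP WY].
  case=> [[UC _ XG]|[UC XD]|[-> XE]]; rewrite /f /= limg_dim_eq.
  - exact: dimG.
  - by rewrite lker_embed ?capv0 ?dimC.
  - exact: dimD.
  - by rewrite lker_embed ?capv0 ?dimCC.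
  - exact: dimE.
  apply/eqP; rewrite -subv0 -(lker_embed_cap k m (0 : {vspace 'rV[F]_n})) capvC.
  by rewrite capvS ?sES.
(* Over equal base spaces both local codewords belong to the same one of [G], [D], [E], and the
   intersection is computed in [F^(k + m)]. *)
have [eq_UW|ne_UW _] := eqVneq U W.
  rewrite -eq_UW {W eq_UW} in WY *.
  rewrite xpair_eqE eqxx /= => ne_XY; rewrite /f /=.
  have inj_cap : \dim U = k -> (\dim (X :&: Y) <= 1)%N ->
    (\dim (embed k m U @: X :&: embed k m U @: Y) <= 1)%N.
    move=> dimU le1.
    rewrite (limg_cap_in (T := fullv)) ?subvf ?lker_embed ?cap0v //.
    by rewrite limg_dim_eq ?lker_embed ?capv0.
  case: UX => [[UC UCC XG]|[UC XD]|[U0 XE]];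
    case: WY => [[UC' UCC' YG]|[UC' YD]|[U0' YE]].
  - by rewrite inj_cap ?dimC ?capG.
  - by rewrite UC' in UCC.
  - by rewrite U0' (negPf C0) in UC.
  - by rewrite UC in UCC'.
  - by rewrite inj_cap ?dimCC ?capD.
  - by rewrite U0' (negPf CC0) in UC.
  - by rewrite U0 (negPf C0) in UC'.
  - by rewrite U0 (negPf CC0) in UC'.
  rewrite U0 (limg_cap_in (T := S)) ?lker_embed_cap ?sES //.
  have le1 : (\dim (X :&: Y) <= 1)%N by apply: capE.
  apply: leq_trans le1.
  rewrite -[X in (_ <= X)%N](limg_ker_dim (embed k m (0 : {vspace 'rV[F]_n}))).
  exact: leq_addl.
(* Over distinct base spaces: a codeword from [G] contributes 0 with [S'] and [U :&: W] at most 1;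
   two members of [CC] give 0 and at most 1; the base space 0 makes [U :&: W] zero. *)
case: UX => [[UC UCC XG]|[UC XD]|[U0 XE]].
- apply: boundl; rewrite capG' // addn0; case: WY => [[WC _ _]|[WC _]|[-> _]].
  + exact: capC.
  + by apply: capC => //; apply: subsetP WC.
  by rewrite capv0 dimv0.
- case: WY => [[WC _ YG]|[WC YD]|[W0 YE]].
  + apply: boundr; rewrite capG' // addn0.
    by apply: capC => //; apply: subsetP UC.
  + by apply: boundl; rewrite capCC // dimv0 add0n capD'.
  by apply: boundl; rewrite W0 capv0 dimv0 add0n capD'.
case: WY => [[WC _ YG]|[WC YD]|[W0 YE]].
- by apply: boundr; rewrite U0 cap0v dimv0 capG'.
- by apply: boundr; rewrite U0 cap0v dimv0 add0n capD'.
by rewrite U0 W0 eqxx in ne_UW.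
Qed.

(** * The lifted Gabidulin code and the final bound *)

(** The codewords are the graphs of [y |-> y A]. The graphs of [A] and [B] meet exactly above the
    kernel of [A - B]. *)
Lemma lifted_gabidulin_code (F : finFieldType) (k m : nat)
    (S := lker (lproj F m k)) : (1 < k <= m)%N ->
  exists G : {set {vspace 'rV[F]_(k + m)}},
  [/\ #|G| = (#|F| ^ (2 * m))%N, {in G, forall X, \dim X = k},
      {in G &, forall X Y, X != Y -> (\dim (X :&: Y) <= 1)%N}
    & {in G, forall X, (X :&: S)%VS = 0%VS}].
Proof.
move=> km; have [M cardM capM] := gabidulin_code F km.
pose g A : 'Hom('rV[F]_k, 'rV[F]_(k + m)) := linfun (mulmxr (row_mx 1%:M A)).
have gE A y : g A y = row_mx y (y *m A) by rewrite lfunE /= mul_mx_row mulmx1.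
have kerg A : lker (g A) = 0%VS.
  apply/eqP/lker0P=> y z; rewrite !gE.
  by case/eq_row_mx.
have dimg A : \dim (limg (g A)) = k.
  by rewrite limg_dim_eq ?kerg ?capv0 // dimvf dim_matrix mul1r.
have capg A B : (\dim (limg (g A) :&: limg (g B))
    <= \dim (lker (linfun (mulmxr (A - B) : 'rV[F]_k -> 'rV[F]_m))))%N.
  rewrite -[X in (_ <= X)%N](limg_dim_eq (f := g A)) ?kerg ?capv0 //.
  apply/dimvS/subvP=> _ /memv_capP[/memv_imgP[y _ ->] /memv_imgP[z _]].
  rewrite !gE => /eq_row_mx[<- eq_y]; rewrite -gE; apply: memv_img.
  by rewrite memv_ker lfunE /= mulmxBr eq_y subrr eqxx.
have g_inj : {in M &, injective (fun A => limg (g A))}.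
  move=> A B MA MB /= eq_g; apply/eqP/negPn/negP => /(capM A B MA MB).
  apply/negP; rewrite -ltnNge; apply: leq_trans (capg A B).
  by rewrite eq_g capvv dimg; case/andP: km.
exists [set limg (g A) | A in M]; split.
- by rewrite card_in_imset.
- by move=> _ /imsetP[A _ ->].
- move=> _ _ /imsetP[A MA ->] /imsetP[B MB ->] ne_g.
  by rewrite (leq_trans (capg A B)) // capM //; apply: contraNneq ne_g => ->.
move=> _ /imsetP[A _ ->]; apply/eqP; rewrite -subv0; 
apply/subvP=> _ /memv_capP[/memv_imgP[y _ ->]]; rewrite memv_ker.
by rewrite lprojE gE row_mxKl => /eqP->; rewrite mul0mx row_mx0 mem0v.
Qed.

Lemma dim_lker_lproj (F : fieldType) (k m : nat) :
  \dim (lker (lproj F m k)) = m.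
Proof.
apply/eqP; rewrite -(eqn_add2r (\dim (limg (lproj F m k)))).
rewrite -{1}(capfv (lker _)) limg_ker_dim (_ : limg _ = fullv).
  by rewrite !dimvf !dim_matrix !mul1r addnC.
apply/vspaceP=> y; rewrite memvf; apply/memv_imgP.
by exists (row_mx y 0); rewrite ?memvf // lprojE row_mxKl.
Qed.

(** The bound is over the integers because the factor of [#|C1C|] may be negative. It fails for
    [k = 1]: with [v1 = 1], [v2 = 2], [C1] the whole line and [C1C] empty, it would give
    [q^2 + Lambda <= q + 1]. *)
Theorem theorem3 (F : finFieldType) (q : nat) (hq : #|F| = q)
    (k v1 v2 : nat) (hk : (1 < k)%N) (hv1 : (0 < v1)%N) (hv2 : (0 < v2)%N)
    (hv2k : (2 * k <= v2)%N)
    (C1 : {set {vspace 'rV[F]_v1}})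
    (hC1dim : forall U, U \in C1 -> \dim U = k)
    (hC1 : forall U W, U \in C1 -> W \in C1 -> U <> W ->
      (\dim (U :&: W)%VS <= 1)%N)
    (C1C : {set {vspace 'rV[F]_v1}})
    (hC1C_sub : C1C \subset C1)
    (hC1C : forall U W, U \in C1C -> W \in C1C -> U <> W ->
      (U :&: W)%VS = 0%VS)
    (C2 : {set {vspace 'rV[F]_v2}})
    (hC2dim : forall U, U \in C2 -> \dim U = k)
    (hC2 : forall U W, U \in C2 -> W \in C2 -> U <> W ->
      (\dim (U :&: W)%VS <= 1)%N)
    (hC2card : (1 <= #|C2|)%N)
    (S : {vspace 'rV[F]_v2}) (Lambda : nat)
    (hSdim : \dim S = (v2 - k)%N)
    (hLambda : #|[set U in C2 | (U <= S)%VS]| = Lambda)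
    (hS : forall U, U \in C2 -> ~~ (U <= S)%VS ->
      (\dim (U :&: S)%VS <= 1)%N) :
  (#|C1|%:Z * (q ^ (2 * (v2 - k)))%N%:Z
     + #|C1C|%:Z * (#|C2|%:Z - (q ^ (2 * (v2 - k)))%N%:Z - Lambda%:Z)
     + Lambda%:Z
   <= (Aq F (v1 + v2 - k) (2 * k - 2) k)%:Z)%R.
Proof.
have le_k_v2 : (k <= v2)%N by rewrite (leq_trans _ hv2k) // leq_pmull.
rewrite -addnBA //; set m := (v2 - k)%N in hSdim *.
have def_v2 : (k + m)%N = v2 by rewrite subnKC.
(* The hypothesis [2 * k <= v2] is exactly [k <= m], as the Gabidulin code requires. *)
have km : (1 < k <= m)%N by rewrite hk -(leq_add2l k) def_v2 addnn -mul2n.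
have [G [cardG dimG capG capGS]] := lifted_gabidulin_code F km.
(* [h] moves [S] onto [0 x F^m]; being injective, it preserves the dimensions of codewords and of
   their intersections. *)
have [|h kerh hS0] := exists_iso_limg (U := S) (W := lker (lproj F m k)) _
  (etrans hSdim (esym (dim_lker_lproj F k m))).
  by rewrite !dimvf !dim_matrix !mul1r def_v2.
have ker0h : lker h == 0%VS by rewrite kerh.
have h_inj : injective (fun X => h @: X)%VS.
  by move=> X Y /= eq_h; apply/eqP; rewrite -(eq_limg_ker0 _ _ ker0h) eq_h.
have dimh X : \dim (h @: X) = \dim X by rewrite limg_dim_eq ?kerh ?capv0.
have caph X Y : (h @: X :&: h @: Y)%VS = (h @: (X :&: Y))%VS.
  by rewrite lker0_img_cap.
pose E0 := [set U in C2 | (U <= S)%VS]; pose D0 := C2 :\: E0.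
have sEC : E0 \subset C2 by apply/subsetP=> U; rewrite inE => /andP[].
have sDC : D0 \subset C2 by apply: subsetDl.
have dim_img (Z : {set {vspace 'rV[F]_v2}}) : Z \subset C2 ->
    {in [set h @: X | X in Z]%VS, forall X, \dim X = k}.
  by move=> sZC _ /imsetP[X ZX ->]; rewrite dimh hC2dim ?(subsetP sZC).
have cap_img (Z : {set {vspace 'rV[F]_v2}}) : Z \subset C2 ->
    {in [set h @: X | X in Z]%VS &,
      forall X Y, X != Y -> (\dim (X :&: Y) <= 1)%N}.
  move=> sZC _ _ /imsetP[X ZX ->] /imsetP[Y ZY ->] ne_h.
  rewrite caph dimh hC2 ?(subsetP sZC) // => eq_XY.
  by rewrite eq_XY eqxx in ne_h.
have := leq_linked_code_Aq (C := C1) (CC := C1C) (G := G)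
  (D := [set h @: X | X in D0]%VS) (E := [set h @: X | X in E0]%VS)
  hk hC1dim _ hC1C_sub _ dimG capG capGS (dim_img _ sDC) (cap_img _ sDC) _
  (dim_img _ sEC) (cap_img _ sEC) _.
rewrite !card_imset // hLambda cardG hq !cardsD.
rewrite (setIidPr hC1C_sub) (setIidPr sEC) hLambda => main.
have le1 : (#|C1C| <= #|C1|)%N by apply: subset_leq_card.
have le2 : (Lambda <= #|C2|)%N by rewrite -hLambda; apply: subset_leq_card.
set A := Aq _ _ _ _ in main *.
have {main} : ((#|C1| - #|C1C|) * q ^ (2 * m)
    + #|C1C| * (#|C2| - Lambda) + Lambda <= A)%N.
  apply: main.
  - by move=> U W UC WC /eqP; apply: hC1.
  - by move=> U W UC WC /eqP; apply: hC1C.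
  - move=> _ /imsetP[X + ->]; rewrite !inE -hS0 caph dimh => /andP[+ CX].
    by rewrite CX; apply: hS.
  by move=> _ /imsetP[X + ->]; rewrite inE -hS0 => /andP[_]; apply: limgS.
(* Both truncated subtractions are exact by [le1] and [le2], and expanding gives the stated
   expression. *)
rewrite -lez_nat; apply: le_trans; rewrite !PoszD !PoszM -!subzn //.
by rewrite le_eqVlt; apply/orP; left; apply/eqP; ring.
Qed.
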